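(* Let $\widehat\sigma,\sigma,\widetilde\sigma\subset\mathbb R^2$ be three $C^1$-curves, with or without boundary. Let $\sigma$ and $\widetilde\sigma$ be parametrized by $\boldsymbol Y:\widehat\sigma\to\mathbb R^2$ and $\widetilde{\boldsymbol Y}=\boldsymbol X\circ\boldsymbol Y:\widehat\sigma\to\mathbb R^2$, respectively, where $\boldsymbol X\in C^1(\sigma,\mathbb R^2)$. Then $$\big[\nabla_s\boldsymbol X\cdot\nabla_s(\boldsymbol X-\mathrm{id})\big]\circ\boldsymbol Y\;|\partial_{\widehat{\boldsymbol\tau}}\boldsymbol Y|\ \ge\ |\partial_{\widehat{\boldsymbol\tau}}\widetilde{\boldsymbol Y}|-|\partial_{\widehat{\boldsymbol\tau}}\boldsymbol Y|\qquad\text{on }\widehat\sigma,$$ and equality holds if $\boldsymbol X=\mathrm{id}\in C^1(\sigma,\mathbb R^2)$.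
   Context: The parametrizations are $C^1$ maps. $\widehat{\boldsymbol\tau}$ is the unit tangent of $\widehat\sigma$ and $\partial_{\widehat{\boldsymbol\tau}}$ the directional derivative along it. $\nabla_s$ is the curve gradient on $\sigma$: with $\boldsymbol\tau$ the unit tangent of $\sigma$, $\nabla_s\boldsymbol X=\partial_{\boldsymbol\tau}\boldsymbol X\otimes\boldsymbol\tau$ (in particular $\nabla_s\mathrm{id}=\boldsymbol\tau\otimes\boldsymbol\tau$). The dot between matrices is the Frobenius inner product; $\mathrm{id}$ is the identity map on $\sigma$. *)

(* Defs.v *)
From HB Require Import structures.
From mathcomp Require Import all_boot all_order all_algebra.
From mathcomp Require Import all_classical all_reals all_analysis.
Set Implicit Arguments.
Unset Strict Implicit.
Unset Printing Implicit Defensive.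
Import Order.TTheory GRing.Theory Num.Theory.
Import numFieldNormedType.Exports.
Local Open Scope classical_set_scope.
Local Open Scope ring_scope.

Notation plane R := 'cV[R]_2.

Definition frobenius (R : realType) (m n : nat) (A B : 'M[R]_(m, n)) : R :=
  \sum_i \sum_j A i j * B i j.

(* The norm `|v| that the library puts on matrices is the sup norm, hence a
   separate Euclidean norm. The topologies agree. *)
Definition enorm (R : realType) (v : plane R) : R :=
  Num.sqrt (frobenius v v).

Definition tensor (R : realType) (u v : plane R) : 'M[R]_2 := u *m v^T.

Section OneVariable.
Variable R : realType.
Implicit Types (I : set R) (f : R -> plane R) (t : R).

Definition quotient_in I f t : set_system (plane R) :=
  (s - t)^-1 *: (f s - f t) @[s --> within I t^'].

(* Derivative of f restricted to I: one-sided at an endpoint of I that belongs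
   to I. Values of f outside I are irrelevant. *)
Definition derive_in I f t : plane R := lim (quotient_in I f t).

Definition C1_on I f : Prop :=
  (forall t, I t -> cvg (quotient_in I f t)) /\
  {within I, continuous (derive_in I f)}.

End OneVariable.

Section Curves.
Variable R : realType.
Implicit Types (S : set (plane R)) (I : set R) (g : R -> plane R).
Implicit Types (f tau : plane R -> plane R) (p v : plane R).

(* Local C^1 parametrization of S: a regular C^1 map on a nondegenerate
   interval (endpoints may belong to it or not) that is a homeomorphism onto a
   relatively open part of S; the last clause, together with injectivity, says
   that the image is relatively open and the inverse continuous. *)
Definition local_param S I g : Prop :=
  [/\ is_interval I, (exists a b, [/\ I a, I b & a < b]),
      C1_on I g, (forall t, I t -> derive_in I g t != 0) &
      (forall s t, I s -> I t -> g s = g t -> s = t) /\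
      (forall V, open V -> exists2 U, open U & g @` (I `&` V) = S `&` U)].

(* One-dimensional embedded C^1 submanifold of the plane, with or without
   boundary; boundary points are the images of endpoints belonging to I. *)
Definition C1_curve S : Prop :=
  forall p, S p -> exists I g, local_param S I g /\ (g @` I) p.

Definition C1_map S f : Prop :=
  forall I g, local_param S I g -> C1_on I (f \o g).

(* The tangent vector v = c g'(t) at p = g(t), together with the derivative
   w = c (f o g)'(t) of f along v. *)
Definition tangent_derivative S f p v (w : plane R) : Prop :=
  exists I g t c, [/\ local_param S I g, I t, g t = p,
    v = c *: derive_in I g t & w = c *: derive_in I (f \o g) t].

Definition tangent_vector S p v : Prop :=
  exists I g t c, [/\ local_param S I g, I t, g t = p &
    v = c *: derive_in I g t].

(* No orientation is imposed: the sign of tau may be chosen at each point. *)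
Definition unit_tangent S tau : Prop :=
  forall p, S p -> tangent_vector S p (tau p) /\ enorm (tau p) = 1.

(* For f of class C^1 on S and tau p tangent at p, exactly one w qualifies: it
   does not depend on the local parametrization. *)
Definition dir_derive S tau f p : plane R :=
  xget 0 [set w | tangent_derivative S f p (tau p) w].

Definition curve_grad S tau f p : 'M[R]_2 :=
  tensor (dir_derive S tau f p) (tau p).

Definition parametrizes S0 f S : Prop := C1_map S0 f /\ f @` S0 = S.

End Curves.

(* Main.v *)
Require Import Defs.
From mathcomp Require Import all_boot all_order all_algebra.
From mathcomp Require Import all_classical all_reals all_analysis.
From mathcomp Require Import ring lra.
Import Order.TTheory GRing.Theory Num.Theory.
Import numFieldNormedType.Exports.
Local Open Scope classical_set_scope.
Local Open Scope ring_scope.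
Set Implicit Arguments.
Unset Strict Implicit.
Unset Printing Implicit Defensive.

(** The inequality is pointwise and comes from two facts.

    Chain rule along curves: for a point p with image q = Y p there is one
    scalar k such that the tangential derivative of Y at p is k tau(q) and that
    of X o Y is k w, where w is the derivative of X along tau(q)
    ([dir_derive_comp]). Hence the two speeds are |k| and |k| |w|.

    Algebra: since tau(q) is a unit vector, the Frobenius product of the two
    curve gradients at q is w . (w - tau(q)) = |w|^2 - w . tau(q), which by
    Cauchy-Schwarz is at least |w|^2 - |w| >= |w| - 1
    ([stretch_inequality]). Multiplying by |k| gives the claim. If X is the
    identity on the curve then w = tau(q), and both sides vanish.

    The analytic work is in the chain rule, since Y need not be regular and
    derivatives on a curve are only defined through local parametrizations. If
    h is a differentiable path in the curve and g a local parametrization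
    around h(t) = g(s), then g has a continuous inverse, so h = g o phi near t
    with phi continuous at t. That phi is even differentiable follows from
    g'(s) != 0; then h' = phi' g' and (f o h)' = phi' (f o g)'
    ([reparametrization]). Applied to two parametrizations of the same curve,
    this shows that directional derivatives are well defined
    ([dir_deriveE]); applied to the path traced by Y, it is the chain rule. *)

(** * Euclidean geometry of the plane *)

Section PlaneEuclidean.
Context {R : realType}.
Implicit Types (u v w : plane R) (k : R).

Lemma frobenius_planeE u v :
  frobenius u v = u 0 0 * v 0 0 + u 1 0 * v 1 0.
Proof.
rewrite /frobenius !big_ord_recl !big_ord0 !addr0.
by rewrite (_ : lift ord0 ord0 = 1) //; apply: val_inj.
Qed.

Lemma frobenius_tensor u v w :
  frobenius (tensor u w) (tensor v w) = frobenius u v * frobenius w w.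
Proof.
rewrite [frobenius u v]/frobenius [frobenius w w]/frobenius big_distrlr /=.
apply: eq_bigr => i _; apply: eq_bigr => j _.
by rewrite !mxE !big_ord1 !mxE; ring.
Qed.

Lemma enorm_ge0 v : 0 <= enorm v.
Proof. exact: sqrtr_ge0. Qed.

Lemma sqr_enorm v : enorm v ^+ 2 = frobenius v v.
Proof. by rewrite sqr_sqrtr// frobenius_planeE; nra. Qed.

Lemma enormZ k v : enorm (k *: v) = `|k| * enorm v.
Proof.
rewrite /enorm -sqrtr_sqr -sqrtrM ?sqr_ge0//; congr Num.sqrt.
by rewrite !frobenius_planeE !mxE; ring.
Qed.

Lemma frobenius_le_enorm u v : frobenius u v <= enorm u * enorm v.
Proof.
apply: le_trans (ler_norm _) _.
rewrite -(@ler_pXn2r _ 2)// ?nnegrE ?mulr_ge0 ?enorm_ge0//.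
rewrite exprMn !sqr_enorm real_normK ?num_real// !frobenius_planeE.
by have := sqr_ge0 (u 0 0 * v 1 0 - u 1 0 * v 0 0); nra.
Qed.

(** Cauchy-Schwarz bounds w . v by |w|, and |w|^2 - 2 |w| + 1 is a square;
    v plays the unit tangent and w the derivative of X along it. *)
Lemma stretch_inequality w v : enorm v = 1 ->
  enorm w - 1 <= frobenius w (w - v).
Proof.
move=> v1.
have -> : frobenius w (w - v) = enorm w ^+ 2 - frobenius w v.
  by rewrite sqr_enorm !frobenius_planeE !mxE; ring.
have := frobenius_le_enorm w v; rewrite v1 mulr1.
by have := sqr_ge0 (enorm w - 1); nra.
Qed.

End PlaneEuclidean.

(** * One-sided derivatives and slopes *)

Section OneSidedDerivative.
Context {R : realType}.
Implicit Types (I : set R) (f g h : R -> plane R) (s t : R) (l : plane R).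

(** Makes one-sided limits unique: a nondegenerate interval accumulates at each
    of its points from at least one side. *)
Lemma interval_within_proper I t : is_interval I ->
  (exists a b, [/\ I a, I b & a < b]) -> I t -> ProperFilter (within I t^').
Proof.
move=> itvI [a [b [Ia Ib ab]]] It.
apply: Build_ProperFilter => //.
rewrite /within /= /dnbhs /within /= -nbhs_ballE => -[e /= e0 sub].
have [tb|bt] := ltP t b.
- pose r := Num.min b (t + e / 2).
  have tr : t < r by rewrite lt_min tb ltrDl divr_gt0.
  apply: (sub r) => //.
  + rewrite /ball /= distrC ger0_norm ?subr_ge0 ?(ltW tr)//.
    rewrite ltrBlDl gt_min; apply/orP; right; lra.
  + by rewrite gt_eqF.
  + by apply: (itvI t b) => //; rewrite (ltW tr) /= ge_min lexx.
- have at_ : a < t by apply: lt_le_trans bt.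
  pose r := Num.max a (t - e / 2).
  have rt : r < t by rewrite gt_max at_ ltrBlDr ltrDl divr_gt0.
  apply: (sub r) => //.
  + rewrite /ball /= ger0_norm ?subr_ge0 ?(ltW rt)//.
    rewrite ltrBlDr addrC -ltrBlDr lt_max; apply/orP; right; lra.
  + by rewrite lt_eqF.
  + by apply: (itvI a t) => //; rewrite (ltW rt) andbT le_max lexx.
Qed.

(** Caratheodory's form of differentiability: with the value l filled in at s,
    the increment of g is (x - s) times a function continuous at s. This avoids
    dividing by increments phi(r) - s, which may vanish, when composing. *)
Definition slope g s l (x : R) : plane R :=
  if x == s then l else (x - s)^-1 *: (g x - g s).

Lemma slopeE g s l x : g x - g s = (x - s) *: slope g s l x.
Proof.
rewrite /slope; have [->|xs] := eqVneq; first by rewrite !subrr scale0r.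
by rewrite scalerA divff ?subr_eq0// scale1r.
Qed.

Lemma slope_cvg I g s l : quotient_in I g s --> l ->
  slope g s l x @[x --> within I (nbhs s)] --> l.
Proof.
move=> gl A Al.
have glA : \forall x \near s, x != s -> I x -> A ((x - s)^-1 *: (g x - g s)).
  exact: gl.
change (\forall x \near s, I x -> A (slope g s l x)).
apply: filterS glA => x Hx Ix; rewrite /slope.
have [xs|xs] := eqVneq; first exact: nbhs_singleton.
exact: Hx.
Qed.

Lemma quotient_cvg_continuous I h t l : quotient_in I h t --> l ->
  h r @[r --> within I t^'] --> h t.
Proof.
move=> hl.
have rt : (r - t) @[r --> within I t^'] --> (0 : R).
  rewrite -(subrr t); apply: cvgB; last exact: cvg_cst.
  by apply: cvg_trans (cvg_within _) _; exact: cvg_within.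
have : (r - t) *: ((r - t)^-1 *: (h r - h t)) + h t
    @[r --> within I t^'] --> 0 *: l + h t.
  by apply: cvgD; [exact: cvgZ|exact: cvg_cst].
rewrite scale0r add0r; apply: cvg_trans; apply: near_eq_cvg.
change (\forall r \near t, r != t -> I r ->
  (r - t) *: ((r - t)^-1 *: (h r - h t)) + h t = h r).
by apply: filterE => r rt' _; rewrite scalerA divff ?subr_eq0// scale1r subrK.
Qed.

End OneSidedDerivative.

(** * Paths in a curve and local parametrizations *)

Section Reparametrization.
Context {R : realType}.
Implicit Types (S : set (plane R)) (I J : set R) (g h : R -> plane R).
Implicit Types (s t : R) (l : plane R).

Lemma local_param_sub S I g t : local_param S I g -> I t -> S (g t).
Proof.
move=> [_ _ _ _ [_ op]] It.
have [U _ E] := op _ openT.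
have : (g @` (I `&` setT)) (g t) by exists t.
by rewrite E => -[].
Qed.

Lemma local_param_proper S I g t : local_param S I g -> I t ->
  ProperFilter (within I t^').
Proof. by move=> [? ? _ _ _]; apply: interval_within_proper. Qed.

(** Continuity of the inverse of a local parametrization: a map h with values
    in S converging to g s lifts through g to a map converging to s within J.
    The lift exists because g maps neighbourhoods of s onto relatively open
    parts of S, which h eventually enters. *)
Lemma local_param_inverse S J g s (T : Type) (F : set_system T) {FF : Filter F}
    (h : T -> plane R) :
  local_param S J g -> J s ->
  (\forall r \near F, S (h r)) -> h r @[r --> F] --> g s ->
  exists phi : T -> R,
    (\forall r \near F, J (phi r) /\ g (phi r) = h r) /\
    phi r @[r --> F] --> within J (nbhs s).
Proof.
move=> [_ _ _ _ [inj op]] Js Sh hs.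
(* The default value s is only taken where h r is outside g(J). *)
pose phi r := xget s [set x | J x /\ g x = h r].
have phiP x r : J x -> g x = h r -> phi r = x.
  move=> Jx gx; rewrite /phi; case: xgetP => [y _ [Jy gy]|/(_ x)/=].
    by apply: inj => //; rewrite gy.
  by move/not_andP => -[].
have liftV V : open V -> V s ->
    \forall r \near F, [/\ J (phi r), V (phi r) & g (phi r) = h r].
  move=> oV Vs; have [U oU E] := op _ oV.
  have [_ Ugs] : (S `&` U) (g s) by rewrite -E; exists s.
  have hU : \forall r \near F, U (h r) by apply: hs; exact: open_nbhs_nbhs.
  apply: filterS2 Sh hU => r Sr Ur.
  have : (S `&` U) (h r) by split.
  rewrite -E => -[x [Jx Vx] gx].
  by rewrite (phiP _ _ Jx gx).
exists phi; split.
  by apply: filterS (liftV _ openT Logic.I) => r [].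
move=> A; rewrite /within /= nbhsE => -[V [oV Vs] VA].
apply: filterS (liftV _ oV Vs) => r [Jr Vr _]; exact: VA.
Qed.

(** The path h lifts to h = g o phi near t, and (phi(r) - s) / (r - t) has a
    limit mu: its product with the slope of g at phi(r) tends to l, and that
    slope tends to the nonzero vector g'(s), so a coordinate where g'(s) does
    not vanish can be divided out. Multiplying the same quotient by the slope
    of f o g gives the derivative of f o h. The scalar mu is chosen before f,
    so that all functions f on S share it. *)
Lemma reparametrization S I J g h s t l :
  ProperFilter (within I t^') ->
  (forall r, I r -> S (h r)) -> quotient_in I h t --> l ->
  local_param S J g -> J s -> g s = h t ->
  exists mu, l = mu *: derive_in J g s /\
    forall f : plane R -> plane R, cvg (quotient_in J (f \o g) s) ->
      quotient_in I (f \o h) t --> mu *: derive_in J (f \o g) s.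
Proof.
move=> PF Sh hl lp Js gst.
have ShF : \forall r \near within I t^', S (h r).
  change (\forall r \near t, r != t -> I r -> S (h r)).
  by apply: filterE => r _; exact: Sh.
have hc : h r @[r --> within I t^'] --> g s.
  by rewrite gst; exact: quotient_cvg_continuous hl.
have [phi [phiJ phic]] := local_param_inverse lp Js ShF hc.
case: lp => _ _ [dg _] g'0 _.
(* The difference quotient of phi, which the increments of h and f o h share. *)
pose m r := (r - t)^-1 * (phi r - s).
have key (f : plane R -> plane R) l' :
    (\forall r \near within I t^', m r *: slope (f \o g) s l' (phi r) =
        (r - t)^-1 *: ((f \o h) r - (f \o h) t)).
  apply: filterS phiJ => r [_ E] /=.
  by rewrite -E -gst -scalerA -slopeE.
have sl (f : plane R -> plane R) : cvg (quotient_in J (f \o g) s) ->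
   slope (f \o g) s (derive_in J (f \o g) s) (phi r) @[r --> within I t^']
     --> derive_in J (f \o g) s.
  move=> cf; exact: cvg_comp phic (slope_cvg cf).
pose d := derive_in J g s.
have dgs : slope g s d (phi r) @[r --> within I t^'] --> d.
  exact: (sl id (dg _ Js)).
have md : m r *: slope g s d (phi r) @[r --> within I t^'] --> l.
  apply: cvg_trans hl; apply: near_eq_cvg.
  by apply: filterS (key id d) => r /= ->.
have [i di] : exists i, d i 0 != 0.
  apply/existsP; apply: contraNT (g'0 _ Js); rewrite negb_exists => /forallP d0.
  by apply/eqP/matrixP => i j; rewrite !mxE !ord1; apply/eqP; have := d0 i; rewrite negbK.
have coordc (v : R -> plane R) (x : plane R) : v r @[r --> within I t^'] --> x ->
    v r i 0 @[r --> within I t^'] --> x i 0.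
  by move=> vx; apply: (@cvg_comp _ _ _ v (fun M : plane R => M i 0) _ _ _ vx);
    exact: coord_continuous.
have mc : m r @[r --> within I t^'] --> l i 0 / d i 0.
  have : (m r *: slope g s d (phi r)) i 0 / slope g s d (phi r) i 0
     @[r --> within I t^'] --> l i 0 / d i 0.
    by apply: cvgM; [exact: coordc|apply: cvgV => //; exact: coordc].
  apply: cvg_trans; apply: near_eq_cvg.
  have : \forall r \near within I t^', slope g s d (phi r) i 0 != 0.
    apply: (coordc _ _ dgs [set x | x != 0]).
    by apply: open_nbhs_nbhs; split => //; exact: open_neq.
  by apply: filterS => r nz; rewrite mxE mulfK.
exists (l i 0 / d i 0); split.
  by apply: (cvg_unique _ md); [exact: norm_hausdorff|exact: cvgZ].
move=> f cf.
have : m r *: slope (f \o g) s (derive_in J (f \o g) s) (phi r)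
   @[r --> within I t^'] --> (l i 0 / d i 0) *: derive_in J (f \o g) s.
  by apply: cvgZ => //; exact: sl.
apply: cvg_trans; apply: near_eq_cvg.
by apply: filterS (key f (derive_in J (f \o g) s)) => r /= ->.
Qed.

End Reparametrization.

(** * Derivatives along the tangent *)

Section DirectionalDerivative.
Context {R : realType}.
Implicit Types (S : set (plane R)) (I : set R) (g : R -> plane R).
Implicit Types (f tau X Y : plane R -> plane R) (p l : plane R) (t c : R).

(** Differentiability is tested along local parametrizations only, since f
    matters only on S. *)
Definition differentiable_along S f : Prop :=
  forall I g t, local_param S I g -> I t -> cvg (quotient_in I (f \o g) t).

Lemma C1_map_differentiable_along S f : C1_map S f -> differentiable_along S f.
Proof. by move=> C1f I g t lp It; have [+ _] := C1f _ _ lp; apply. Qed.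

Lemma derive_inE S I g (h : R -> plane R) t l : local_param S I g -> I t ->
  quotient_in I h t --> l -> derive_in I h t = l.
Proof.
move=> lp It hl; have PF := local_param_proper lp It.
by apply: cvg_lim hl; exact: norm_hausdorff.
Qed.

(** Independence of the parametrization: any other admissible pair c1, g1 has
    g1' = mu g' and (f o g1)' = mu (f o g)' by [reparametrization], and
    c1 mu = c because both multiples of g' equal tau p and g' != 0. *)
Lemma dir_deriveE S tau f p I g t c :
  local_param S I g -> I t -> g t = p -> tau p = c *: derive_in I g t ->
  cvg (quotient_in I (f \o g) t) ->
  dir_derive S tau f p = c *: derive_in I (f \o g) t.
Proof.
move=> lp It gt tauE cf; rewrite /dir_derive.
case: xgetP => [w _ /= [I1 [g1 [t1 [c1 [lp1 It1 gt1 tau1 ->]]]]]|]; last first.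
  by move/(_ (c *: derive_in I (f \o g) t)) => /=; case; exists I, g, t, c.
have PF := local_param_proper lp1 It1.
have [_ _ [dg1 _] _ _] := lp1; have [_ _ _ g'0 _] := lp.
have [//||mu [g1E fE]] := reparametrization PF _ (dg1 _ It1) lp It.
- by move=> r; exact: local_param_sub lp1.
- by rewrite gt gt1.
rewrite (derive_inE lp1 It1 (fE _ cf)) scalerA; congr (_ *: _).
rewrite -[lim _]/(derive_in I1 g1 t1) in g1E.
move/eqP: tauE; rewrite tau1 g1E scalerA -subr_eq0 -scalerBl scaler_eq0.
by rewrite (negPf (g'0 _ It)) orbF subr_eq0 => /eqP.
Qed.

(** The path Y o g, for g a parametrization of S0, runs in S, so
    [reparametrization] compares it with a parametrization of S. The factor k
    vanishes where Y is singular, and its sign depends on the choices of tau0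
    and tau. *)
Lemma dir_derive_comp S0 S tau0 tau Y p :
  unit_tangent S0 tau0 -> unit_tangent S tau -> (forall q, S0 q -> S (Y q)) ->
  differentiable_along S0 Y -> S0 p ->
  exists k, dir_derive S0 tau0 Y p = k *: tau (Y p) /\
    forall f, differentiable_along S f ->
      dir_derive S0 tau0 (f \o Y) p = k *: dir_derive S tau f (Y p).
Proof.
move=> ut0 ut SY dY S0p.
have [[I [g [t [c [lp It gt tau0E]]]]] _] := ut0 _ S0p.
have [[J [h [s [d [lq Js hs tauE]]]]] tau1] := ut _ (SY _ S0p).
have PF := local_param_proper lp It.
have dYg := dY _ _ _ lp It.
have [||mu [YE fE]] := reparametrization PF _ dYg lq Js.
- by move=> r Ir; apply: SY; exact: local_param_sub lp Ir.
- by rewrite hs /= gt.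
have d0 : d != 0.
  apply/eqP => d0; move: tau1; rewrite tauE d0 enormZ normr0 mul0r => /eqP.
  by rewrite eq_sym oner_eq0.
rewrite -[lim _]/(derive_in I (Y \o g) t) in YE.
exists (c * mu / d); split.
  rewrite (dir_deriveE lp It gt tau0E dYg).
  by rewrite YE tauE !scalerA mulfVK.
move=> f df; have dfh := df _ _ _ lq Js.
rewrite (dir_deriveE lq Js hs tauE dfh).
have cfY : cvg (quotient_in I ((f \o Y) \o g) t).
  by apply/cvg_ex; exists (mu *: derive_in J (f \o h) s); exact: fE.
rewrite (dir_deriveE lp It gt tau0E cfY).
by rewrite (derive_inE lp It (fE _ dfh)) !scalerA mulfVK.
Qed.

Lemma dir_derive_subid S tau X p : unit_tangent S tau -> S p ->
  differentiable_along S X ->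
  dir_derive S tau (X \- id) p = dir_derive S tau X p - tau p.
Proof.
move=> ut Sp dX.
have [[I [g [t [c [lp It gt tauE]]]]] _] := ut _ Sp.
have [_ _ [dg _] _ _] := lp.
have cB : quotient_in I ((X \- id) \o g) t
    --> derive_in I (X \o g) t - derive_in I g t.
  have PF := local_param_proper lp It.
  rewrite /quotient_in; under eq_cvg => s.
    rewrite (_ : _ *: _ = (s - t)^-1 *: ((X \o g) s - (X \o g) t)
      - (s - t)^-1 *: (g s - g t)); last first.
      by rewrite -scalerBr /= [in LHS]opprD addrACA -opprD.
    over.
  by apply: cvgB; [exact: dX|exact: dg].
rewrite (dir_deriveE lp It gt tauE (dX _ _ _ lp It)).
rewrite (dir_deriveE lp It gt tauE); last first.
  by apply/cvg_ex; eexists; exact: cB.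
by rewrite (derive_inE lp It cB) scalerBr tauE.
Qed.

Lemma dir_derive_eqid S tau X p : unit_tangent S tau -> S p ->
  (forall q, S q -> X q = q) -> dir_derive S tau X p = tau p.
Proof.
move=> ut Sp Xid.
have [[I [g [t [c [lp It gt tauE]]]]] _] := ut _ Sp.
have [_ _ [dg _] _ _] := lp.
have cX : quotient_in I (X \o g) t --> derive_in I g t.
  apply: cvg_trans (dg _ It); apply: near_eq_cvg.
  change (\forall r \near t, r != t -> I r ->
    (r - t)^-1 *: (g r - g t) = (r - t)^-1 *: (X (g r) - X (g t))).
  apply: filterE => r _ Ir.
  by rewrite !Xid //; apply: local_param_sub lp _.
rewrite (dir_deriveE lp It gt tauE); last first.
  by apply/cvg_ex; eexists; exact: cX.
by rewrite (derive_inE lp It cX).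
Qed.

End DirectionalDerivative.

(** * The stretching inequality *)

Theorem lemma2p1 (R : realType)
    (sigma_hat sigma sigma_tilde : set (plane R))
    (tau_hat tau X Y : plane R -> plane R) :
  C1_curve sigma_hat -> C1_curve sigma -> C1_curve sigma_tilde ->
  unit_tangent sigma_hat tau_hat -> unit_tangent sigma tau ->
  parametrizes sigma_hat Y sigma ->
  C1_map sigma X ->
  parametrizes sigma_hat (X \o Y) sigma_tilde ->
  (forall p, sigma_hat p ->
     frobenius (curve_grad sigma tau X (Y p))
               (curve_grad sigma tau (X \- id) (Y p))
       * enorm (dir_derive sigma_hat tau_hat Y p)
     >= enorm (dir_derive sigma_hat tau_hat (X \o Y) p)
        - enorm (dir_derive sigma_hat tau_hat Y p)) /\
  ((forall q, sigma q -> X q = q) ->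
   forall p, sigma_hat p ->
     frobenius (curve_grad sigma tau X (Y p))
               (curve_grad sigma tau (X \- id) (Y p))
       * enorm (dir_derive sigma_hat tau_hat Y p)
     = enorm (dir_derive sigma_hat tau_hat (X \o Y) p)
       - enorm (dir_derive sigma_hat tau_hat Y p)).
Proof.
move=> _ _ _ ut0 ut [C1Y YS] C1X _.
have dX : differentiable_along sigma X by exact: C1_map_differentiable_along.
have dY : differentiable_along sigma_hat Y
  by exact: C1_map_differentiable_along.
have SY q : sigma_hat q -> sigma (Y q) by move=> Sq; rewrite -YS; exists q.
have normE q : sigma q ->
    frobenius (curve_grad sigma tau X q) (curve_grad sigma tau (X \- id) q) =
    frobenius (dir_derive sigma tau X q) (dir_derive sigma tau X q - tau q).
  move=> Sq; rewrite frobenius_tensor dir_derive_subid// -sqr_enorm.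
  by have [_ ->] := ut _ Sq; rewrite expr1n mulr1.
have stretch p : sigma_hat p -> exists2 k : R, 0 <= k &
    enorm (dir_derive sigma_hat tau_hat Y p) = k /\
    enorm (dir_derive sigma_hat tau_hat (X \o Y) p) =
      k * enorm (dir_derive sigma tau X (Y p)).
  move=> Sp; have [k [YE XYE]] := dir_derive_comp ut0 ut SY dY Sp.
  exists `|k|; rewrite // YE XYE// !enormZ.
  by have [_ ->] := ut _ (SY _ Sp); rewrite mulr1.
split => [p Sp|Xid p Sp]; have [k k0 [-> ->]] := stretch p Sp;
    rewrite (normE _ (SY _ Sp)); have [_ tau1] := ut _ (SY _ Sp).
  rewrite -[X in _ - X <= _]mulr1 -mulrBr mulrC ler_wpM2r//.
  exact: stretch_inequality.
rewrite (dir_derive_eqid ut (SY _ Sp) Xid) tau1 subrr.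
by rewrite frobenius_planeE !mxE; ring.
Qed.
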